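(* Let $\Gamma^1,\Gamma^2,\dots,\Gamma^m\in\mathbb{R}^{2n\times2n}$ be covariance matrices (of fermionic states on $n$ modes), and let $\{p_i\}_{i=1}^m$ be any probability distribution. Then there exists a fermionic Gaussian state whose covariance matrix is $\Gamma=\sum_{i=1}^mp_i\Gamma^i$.
   Context: Majorana operators $c_1,\dots,c_{2n}\in\mathbb{C}^{2^n\times2^n}$ are Hermitian with $c_jc_k+c_kc_j=2\delta_{jk}\mathbb{1}$. A fermionic density matrix is an even polynomial $\rho$ in the $c_j$ with $\rho\succeq0$, $\mathrm{Tr}(\rho)=1$. Its covariance matrix is $\Gamma_{j,k}=\frac i2\mathrm{Tr}(\rho[c_j,c_k])$, a real anti-symmetric $2n\times2n$ matrix. Fermionic Gaussian state: a density matrix of the form $\rho=\frac{1}{2^n}\prod_{j=1}^n(\mathbb{1}+i\lambda_j\tilde c_{2j-1}\tilde c_{2j})$ with $\lambda_j\in[-1,1]$ and $\tilde c_j=\sum_kR_{j,k}c_k$ for some $R\in SO(2n)$. *)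

(* Defs.v *)
From mathcomp Require Import all_boot all_order all_algebra.
From mathcomp Require Import reals complex.

Set Implicit Arguments.
Unset Strict Implicit.
Unset Printing Implicit Defensive.

Import Order.TTheory GRing.Theory Num.Theory.
Local Open Scope ring_scope.
Local Open Scope complex_scope.
Local Open Scope sesquilinear_scope.

(* The Majorana operators c_1, ..., c_2n are indexed from 0: the 1-based pair
   (2j-1, 2j) becomes (2j, 2j+1) for j : 'I_n. *)
Fact mode_fst_subproof (n : nat) (j : 'I_n) : (2 * j < 2 * n)%N.
Proof. by rewrite ltn_pmul2l. Qed.

Fact mode_snd_subproof (n : nat) (j : 'I_n) : ((2 * j).+1 < 2 * n)%N.
Proof. by rewrite !mul2n ltn_Sdouble. Qed.

Definition mode_fst (n : nat) (j : 'I_n) : 'I_(2 * n) :=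
  Ordinal (mode_fst_subproof j).
Definition mode_snd (n : nat) (j : 'I_n) : 'I_(2 * n) :=
  Ordinal (mode_snd_subproof j).

Definition psdmx (R : realType) (d : nat) (A : 'M[R[i]]_d) : Prop :=
  A \is hermsymmx /\ forall v : 'cV[R[i]]_d, 0 <= (v^t* *m A *m v) 0 0.

Definition SOmx (R : realType) (d : nat) (Q : 'M[R]_d) : Prop :=
  Q *m Q^T = 1%:M /\ \det Q = 1.

Definition majorana (R : realType) (n : nat)
    (c : 'I_(2 * n) -> 'M[R[i]]_(2 ^ n)) : Prop :=
  (forall j, c j \is hermsymmx) /\
  (forall j k, c j *m c k + c k *m c j = (2 * (j == k)%:R)%:M).

(* A (noncommutative) polynomial is given by a finite list of terms
   (coefficient, word); even means that every word has even length. *)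
Definition even_polynomial (R : realType) (n : nat)
    (c : 'I_(2 * n) -> 'M[R[i]]_(2 ^ n)) (A : 'M[R[i]]_(2 ^ n)) : Prop :=
  exists s : seq (R[i] * seq 'I_(2 * n)),
    all (fun t => ~~ odd (size t.2)) s /\
    A = \sum_(t <- s) t.1 *: \prod_(j <- t.2) c j.

Definition fermionic_density (R : realType) (n : nat)
    (c : 'I_(2 * n) -> 'M[R[i]]_(2 ^ n)) (rho : 'M[R[i]]_(2 ^ n)) : Prop :=
  [/\ even_polynomial c rho, psdmx rho & \tr rho = 1].

Definition covmx (R : realType) (n : nat)
    (c : 'I_(2 * n) -> 'M[R[i]]_(2 ^ n)) (rho : 'M[R[i]]_(2 ^ n)) :
    'M[R[i]]_(2 * n) :=
  \matrix_(j, k) ('i / 2 * \tr (rho *m (c j *m c k - c k *m c j))).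

(* The entries of covmx are real for a Hermitian rho, but have type R[i]. *)
Definition has_covariance (R : realType) (n : nat)
    (c : 'I_(2 * n) -> 'M[R[i]]_(2 ^ n)) (rho : 'M[R[i]]_(2 ^ n))
    (Gamma : 'M[R]_(2 * n)) : Prop :=
  map_mx (real_complex R) Gamma = covmx c rho.

Definition covariance_matrix (R : realType) (n : nat)
    (c : 'I_(2 * n) -> 'M[R[i]]_(2 ^ n)) (Gamma : 'M[R]_(2 * n)) : Prop :=
  exists rho, fermionic_density c rho /\ has_covariance c rho Gamma.

Definition rotate (R : realType) (n : nat) (Q : 'M[R]_(2 * n))
    (c : 'I_(2 * n) -> 'M[R[i]]_(2 ^ n)) (j : 'I_(2 * n)) : 'M[R[i]]_(2 ^ n) :=
  \sum_k (Q j k)%:C *: c k.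

Definition gaussian_state (R : realType) (n : nat)
    (c : 'I_(2 * n) -> 'M[R[i]]_(2 ^ n)) (rho : 'M[R[i]]_(2 ^ n)) : Prop :=
  fermionic_density c rho /\
  exists (Q : 'M[R]_(2 * n)) (lambda : 'I_n -> R),
    [/\ SOmx Q,
        forall j, -1 <= lambda j <= 1 &
        rho = (2 ^+ n)^-1 *:
          \prod_(j < n) (1%:M + ('i * (lambda j)%:C) *:
            (rotate Q c (mode_fst j) *m rotate Q c (mode_snd j)))].

(* Main.v *)
(** The mixture of the given states with weights p_i is a fermionic state with
    covariance matrix G = sum_i p_i G_i, so it suffices to treat one state.
    A rotation Q in SO(2n) brings the skew-symmetric G to a direct sum of blocks
    [[0, l_k], [-l_k, 0]].  For the rotated Majorana operators c~ the Hermitian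
    involution h_k = i c~_(2k) c~_(2k+1) has expectation l_k in the mixture,
    hence |l_k| <= 1, and the Gaussian state 2^-n prod_k (1 + l_k h_k) has the
    same covariance matrix: all traces involved follow from the fact that a
    matrix anticommuting with an involution is traceless. *)

Require Import Defs.
From mathcomp Require Import all_boot all_order all_algebra.
From mathcomp Require Import reals complex.
From mathcomp Require Import ring lra.

Set Implicit Arguments.
Unset Strict Implicit.
Unset Printing Implicit Defensive.

Import Order.TTheory GRing.Theory Num.Theory.
Local Open Scope ring_scope.
Local Open Scope complex_scope.
Local Open Scope sesquilinear_scope.

(** * Normal form of real skew-symmetric matrices *)

Lemma rV_norm_eq0 (F : realDomainType) (k : nat) (u : 'rV[F]_k) :
  (u *m u^T) 0 0 = 0 -> u = 0.
Proof.
rewrite mxE => /eqP; rewrite psumr_eq0 => [/allP u0|i _]; last first.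
  by rewrite mxE -expr2 sqr_ge0.
apply/rowP=> i; have /implyP/(_ isT) := u0 i (mem_index_enum i).
by rewrite !mxE mulf_eq0 orbb => /eqP.
Qed.

Lemma rV_normalize (F : rcfType) (k : nat) (u : 'rV[F]_k) :
  u != 0 -> exists2 a, a != 0 & (a *: u) *m (a *: u)^T = 1%:M.
Proof.
move=> u0; pose s := (u *m u^T) 0 0.
have s_ge0 : 0 <= s.
  by rewrite /s mxE sumr_ge0 // => i _; rewrite mxE -expr2 sqr_ge0.
have s_neq0 : s != 0 by apply: contraNneq u0 => /rV_norm_eq0 ->.
exists (Num.sqrt s)^-1.
  by rewrite invr_eq0 sqrtr_eq0 -ltNge lt_neqAle eq_sym s_neq0.
rewrite linearZ /= -scalemxAl -scalemxAr scalerA [u *m _]mx11_scalar -/s.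
by rewrite -scalemx1 scalerA -invfM -expr2 sqr_sqrtr // mulVf // scale1r.
Qed.

(** The reflection in the hyperplane orthogonal to [w = u - v] swaps [u] and [v], because their
    norms agree. *)
Lemma householder (F : realFieldType) (k : nat) (u v : 'rV[F]_k) :
  u *m u^T = v *m v^T -> exists2 Q : 'M[F]_k, Q *m Q^T = 1%:M & u *m Q = v.
Proof.
move=> uv; have [->|] := eqVneq u v.
  by exists 1%:M; rewrite ?trmx1 mulmx1.
rewrite -subr_eq0; set w := u - v => w0.
pose s : F := (w *m w^T) 0 0.
have s0 : s != 0 by apply: contraNneq w0 => /rV_norm_eq0 ->.
have ww : w *m w^T = s%:M by rewrite [LHS]mx11_scalar.
(* Equality of the norms gives [|w|^2 = 2 (u, w)], whence the half. *)
have uw : u *m w^T = (s / 2)%:M.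
  have vu : v *m u^T = u *m v^T.
    by rewrite [RHS]mx11_scalar -tr_scalar_mx -mx11_scalar trmx_mul trmxK.
  have : u *m w^T + u *m w^T = s%:M.
    rewrite -ww /w linearB /= !mulmxBr !mulmxBl vu -uv opprB.
    by rewrite addrACA -opprD addrC addrA.
  rewrite -mulr2n -scaler_nat => /(congr1 ( *:%R 2^-1)).
  by rewrite scalerA mulVf ?pnatr_eq0 // scale1r => ->; rewrite scale_scalar_mx mulrC.
exists (1%:M - (2 / s) *: (w^T *m w)); last first.
  rewrite mulmxBr mulmx1 -scalemxAr mulmxA uw mul_scalar_mx scalerA.
  have -> : 2 / s * (s / 2) = 1 by field.
  by rewrite scale1r /w opprB addrC subrK.
have -> : (1%:M - (2 / s) *: (w^T *m w))^T = 1%:M - (2 / s) *: (w^T *m w).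
  by rewrite linearB linearZ /= trmx1 trmx_mul trmxK.
rewrite mulmxBr mulmx1 mulmxBl.
rewrite mul1mx -scalemxAl -scalemxAr mulmxA -[w^T *m w *m _]mulmxA ww.
rewrite mul_mx_scalar -scalemxAl !scalerA -addrA -opprD -scalerBl -scalerDl.
rewrite [X in X *: _](_ : _ = 0) ?scale0r ?subr0 //.
by field.
Qed.

(** An orthogonal matrix sending the first basis vector to [x], as [householder] provides, has first
    row [x]. *)
Lemma orthogonal_first_row (F : realFieldType) (k : nat) (x : 'rV[F]_k.+1) :
  x *m x^T = 1%:M -> exists2 Q : 'M[F]_k.+1, Q *m Q^T = 1%:M & row 0 Q = x.
Proof.
move=> xx; have [|Q QQ xQ] := @householder _ _ (delta_mx 0 0) x.
  by rewrite xx trmx_delta mul_delta_mx [LHS]mx11_scalar mxE.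
by exists Q; rewrite // rowE.
Qed.

Lemma orthogonal_block (F : fieldType) (j k : nat) (Q : 'M[F]_k) :
  Q *m Q^T = 1%:M ->
  block_mx (1%:M : 'M_j) 0 0 Q *m (block_mx 1%:M 0 0 Q)^T = 1%:M.
Proof.
move=> QQ; rewrite tr_block_mx !trmx0 trmx1 mulmx_block.
by rewrite !mulmx0 !mul0mx !addr0 add0r mulmx1 QQ -scalar_mx_block.
Qed.

Lemma orthogonal_mul (F : fieldType) (k : nat) (P Q : 'M[F]_k) :
  P *m P^T = 1%:M -> Q *m Q^T = 1%:M -> (P *m Q) *m (P *m Q)^T = 1%:M.
Proof.
by move=> PP QQ; rewrite trmx_mul mulmxA -(mulmxA P) QQ mulmx1.
Qed.

(** In an orthonormal basis starting with [x], the vector [y] has first coordinate 0, so it remains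
    to complete its other coordinates in one dimension less. *)
Lemma orthogonal_first_two_rows (F : realFieldType) (k : nat)
    (x y : 'rV[F]_(2 + k)) :
  x *m x^T = 1%:M -> y *m y^T = 1%:M -> x *m y^T = 0 ->
  exists Q : 'M[F]_(2 + k),
    [/\ Q *m Q^T = 1%:M, row 0 Q = x & row 1 Q = y].
Proof.
move=> xx yy xy; have [P PP Px] := orthogonal_first_row xx.
pose z : 'rV_(1 + k.+1) := y *m P^T.
have zl : lsubmx z = 0.
  apply/rowP=> i; rewrite ord1 !mxE.
  transitivity ((x *m y^T) 0 0); last by rewrite xy mxE.
  rewrite mxE; apply: eq_bigr => j _; rewrite -Px !mxE mulrC.
  by congr (P _ _ * _); apply: val_inj.
have zz : rsubmx z *m (rsubmx z)^T = 1%:M.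
  have : z *m z^T = 1%:M.
    by rewrite /z trmx_mul trmxK mulmxA -(mulmxA y) (mulmx1C PP) mulmx1.
  by rewrite -{1 2}[z]hsubmxK zl tr_row_mx mul_row_col mul0mx add0r.
have [H HH Hz] := orthogonal_first_row zz.
exists (block_mx (1%:M : 'M_1) 0 0 H *m P); split.
- exact: (orthogonal_mul (orthogonal_block 1 HH) PP).
- rewrite row_mul -Px [RHS]rowE; congr (_ *m _).
  apply/rowP=> j; rewrite !mxE; case: splitP => i // _.
  rewrite !mxE; case: splitP => j' jj'; rewrite !mxE -[j == 0]val_eqE /= jj' //.
  by rewrite !ord1.
rewrite row_mul.
suff -> : row 1 (block_mx (1%:M : 'M_1) 0 0 H) = z.
  by rewrite /z -mulmxA (mulmx1C PP) mulmx1.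
rewrite -[z]hsubmxK zl -Hz; apply/rowP=> j; rewrite !mxE.
case: splitP => i; first by rewrite ord1.
move=> /= /eqP; rewrite eq_sym eqSS => /eqP i0.
have {i i0} -> : i = 0 by apply: val_inj.
by rewrite !mxE; case: splitP => j' _; rewrite !mxE.
Qed.

Lemma skew_drsubmx (F : pzRingType) (j k : nat) (A : 'M[F]_(j + k)) :
  A^T = - A -> (drsubmx A)^T = - drsubmx A.
Proof.
move=> /matrixP skewA; apply/matrixP=> i i'.
by have := skewA (rshift j i) (rshift j i'); rewrite !mxE.
Qed.

Lemma skew_dlsubmx (F : pzRingType) (j k : nat) (A : 'M[F]_(j + k)) :
  A^T = - A -> dlsubmx A = - (ursubmx A)^T.
Proof.
move=> /matrixP skewA; apply/matrixP=> i i'.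
by have := skewA (lshift k i') (rshift j i); rewrite !mxE.
Qed.

Lemma skew_congr (F : comPzRingType) (k : nat) (A Q : 'M[F]_k) :
  A^T = - A -> (Q *m A *m Q^T)^T = - (Q *m A *m Q^T).
Proof.
by move=> skewA; rewrite !trmx_mul trmxK skewA mulNmx mulmxN mulmxA.
Qed.

(** A 1 by 1 matrix is its own transpose, while skewness of [A] turns this transpose into the
    negative. *)
Lemma skew_form0 (F : numFieldType) (k : nat) (A : 'M[F]_k) (x : 'rV[F]_k) :
  A^T = - A -> x *m A *m x^T = 0.
Proof.
move=> skewA; set M := x *m A *m x^T.
have : M = - M.
  rewrite {1}[M]mx11_scalar -tr_scalar_mx -mx11_scalar /M !trmx_mul trmxK skewA.
  by rewrite mulNmx mulmxN mulmxA.
by move/eqP; rewrite -addr_eq0 -mulr2n -scaler_nat scaler_eq0 pnatr_eq0 => /eqP.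
Qed.

(** In odd size [\det A = \det A^T = - \det A], so [A] is singular. *)
Lemma skew_odd_kernel (F : numFieldType) (k : nat) (A : 'M[F]_k) :
  odd k -> A^T = - A -> exists2 v : 'rV[F]_k, v != 0 & v *m A = 0.
Proof.
move=> oddk skewA; apply/det0P/eqP.
have : \det A = - \det A.
  by rewrite -{1}det_tr skewA -scaleN1r detZ -signr_odd oddk expr1 mulN1r.
by move/eqP; rewrite -addr_eq0 -mulr2n -mulr_natr mulf_eq0 pnatr_eq0 orbF => /eqP.
Qed.

(** Over [F[i]] the matrix is Hermitian, so the spectral theorem gives a real eigenvalue, which is
    already an eigenvalue over [F]. *)
Lemma symmetric_eigenvalue (F : rcfType) (k : nat) (S : 'M[F]_k.+1) :
  S^T = S -> exists a, eigenvalue S a.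
Proof.
move=> symS; pose C := F[i]; pose SC : 'M[C]_k.+1 := map_mx (real_complex F) S.
have SCherm : SC \is hermsymmx.
  apply: realsym_hermsym.
    by apply/is_hermitianmxP; rewrite scale1r map_mx_id // map_trmx symS.
  by apply/mxOverP=> i j; rewrite mxE; apply/complex_realP; exists (S i j).
have [a da] : exists a, spectral_diag SC 0 0 = a%:C.
  by apply/complex_realP; move/mxOverP: (hermitian_spectral_diag_real SCherm); apply.
exists a; suff : eigenvalue SC a%:C by rewrite eigenvalue_map.
rewrite -da.
have Punit := spectral_unit SC.
(* The rows of the diagonalising matrix are left eigenvectors; row 0 is nonzero since that matrix is
   invertible. *)
apply/eigenvalueP; exists (row 0 (spectralmx SC)); last first.
  apply: contraTneq Punit => /rowP r0.
  rewrite unitmxE (expand_det_row _ 0) big1 ?unitr0 // => j _.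
  by have := r0 j; rewrite !mxE => ->; rewrite mul0r.
have := congr1 (mulmx (spectralmx SC)) (orthomx_spectralP (hermitian_normalmx SCherm)).
rewrite -mulmxA mulKVmx // -row_mul => ->.
by apply/rowP=> j; rewrite mul_diag_mx !mxE.
Qed.

(* An eigenvector x of A^2 spans with x A an invariant plane; if x A = 0, the
   orthogonal complement of x has odd dimension, so A kills a vector there. *)
Lemma skew_invariant_pair (F : rcfType) (k : nat) (A : 'M[F]_(2 + k)) :
  ~~ odd k -> A^T = - A -> exists x y : 'rV_(2 + k), exists t,
    [/\ x *m x^T = 1%:M, y *m y^T = 1%:M, x *m y^T = 0,
        x *m A = t *: y & y *m A = - t *: x].
Proof.
move=> evenk skewA.
have [a /eigenvalueP[x0 x0A x0_neq0]] : exists a, eigenvalue (A *m A) a.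
  by apply: symmetric_eigenvalue; rewrite trmx_mul skewA mulNmx mulmxN opprK.
have [b _ xx] := rV_normalize x0_neq0; set x := b *: x0 in xx.
have xAA : x *m A *m A = a *: x.
  by rewrite -mulmxA -scalemxAl x0A !scalerA mulrC.
clearbody x.
have [xA|xA] := eqVneq (x *m A) 0; last first.
  have [t t0 yy] := rV_normalize xA; set y := t *: _ in yy.
  have xAy : x *m A = t^-1 *: y by rewrite scalerA mulVf // scale1r.
  exists x, y, t^-1; split => //.
    rewrite /y linearZ /= -scalemxAr trmx_mul skewA mulNmx mulmxN mulmxA.
    by rewrite skew_form0 // oppr0 scaler0.
  (* Evaluating [y *m A *m x^T] directly gives [t * a]; evaluating its transpose gives [- t^-1]. *)
  have ta : t * a = - t^-1.
    have yAx : y *m A *m x^T = (t * a)%:M.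
      by rewrite /y -!scalemxAl xAA -scalemxAl xx scalerA scalemx1.
    have : (y *m A *m x^T)^T = (- t^-1)%:M.
      rewrite !trmx_mul trmxK skewA mulNmx mulmxN mulmxA xAy -scalemxAl yy scalemx1.
      by rewrite raddfN.
    by rewrite yAx tr_scalar_mx => /matrixP/(_ 0 0); rewrite !mxE eqxx.
  by rewrite /y -scalemxAl xAA scalerA ta.
(* Degenerate case [x *m A = 0]: in a basis starting with [x] the first column of the matrix
   vanishes, so a kernel vector of the lower right block, padded with 0, is annihilated. *)
have [P PP Px] := orthogonal_first_row xx.
pose A' : 'M_(1 + k.+1) := P *m A *m P^T.
have skewA' : A'^T = - A' := skew_congr P skewA.
have skewB := skew_drsubmx skewA'.
have A'0 : dlsubmx A' = 0.
  have dl0 (M : 'M[F]_(1 + k.+1)) : col 0 M = 0 -> dlsubmx M = 0.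
    move=> /colP M0; apply/matrixP=> i j; have := M0 (rshift 1 i).
    rewrite !mxE ord1 => <-; congr (M _ _); exact: val_inj.
  apply: dl0.
  have PTx : P^T *m delta_mx 0 0 = x^T by rewrite -Px tr_row [RHS]colE.
  rewrite /A' colE -!mulmxA PTx.
  by rewrite -[A]trmxK skewA linearN /= mulNmx -trmx_mul xA trmx0 oppr0 mulmx0.
(* The block has size [k.+1], and [odd k.+1] is [~~ odd k] by computation. *)
have [v v0 vB] := skew_odd_kernel (evenk : odd k.+1) skewB.
have [c _] := rV_normalize v0; set w := c *: v => ww.
have wB : w *m drsubmx A' = 0 by rewrite -scalemxAl vB scaler0.
pose y : 'rV_(1 + k.+1) := row_mx 0 w.
exists x, (y *m P), 0; split => //.
- rewrite trmx_mul mulmxA -(mulmxA y) PP mulmx1 tr_row_mx mul_row_col.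
  by rewrite mul0mx add0r.
- rewrite -Px trmx_mul mulmxA -row_mul PP; apply/rowP=> i.
  rewrite ord1 mxE (bigD1 0) //= big1 ?addr0.
    by rewrite !mxE; case: splitP => // j _; rewrite mxE mulr0.
  by move=> j j0; rewrite !mxE eq_sym (negPf j0) mul0r.
- by rewrite xA scale0r.
rewrite oppr0 scale0r -[A]mul1mx -[A]mulmx1 -(mulmx1C PP).
rewrite !mulmxA -(mulmxA y) PP mulmx1 -(mulmxA y) -(mulmxA y) -[P *m _ *m _]/A'.
have yA' : y *m A' = 0.
  rewrite /y -[A']submxK mul_row_block A'0 wB !mul0mx mulmx0 !addr0.
  exact: row_mx0.
exact: etrans (congr1 (mulmx^~ P) yA') (mul0mx _ _).
Qed.

Lemma ursubmx_row01_eq0 (F : pzRingType) (k : nat) (M : 'M[F]_(2 + k)) (s s' : F) :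
  row 0 M = s *: delta_mx 0 1 -> row 1 M = s' *: delta_mx 0 0 -> ursubmx M = 0.
Proof.
move=> /rowP M0 /rowP M1; apply/matrixP=> i j; rewrite !mxE.
case: (splitP (i : 'I_(1 + 1))) => i' ii'; rewrite ord1 in ii'.
  have := M0 (rshift 2 j); rewrite !mxE andbF mulr0 => <-.
  by congr (M _ _); apply: val_inj.
have := M1 (rshift 2 j); rewrite !mxE andbF mulr0 => <-.
by congr (M _ _); apply: val_inj.
Qed.

(** The condition [i./2 != j./2] says that the indices lie in different 2 by 2 diagonal blocks.
    Splitting off an invariant plane lowers the size by two, hence the strong induction. *)
Lemma orthogonal_skew_normal_form (F : rcfType) (k : nat) (A : 'M[F]_k) :
  ~~ odd k -> A^T = - A ->
  exists2 Q : 'M[F]_k, Q *m Q^T = 1%:M &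
    forall i j : 'I_k, i./2 != j./2 -> (Q *m A *m Q^T) i j = 0.
Proof.
have [h] := ubnP k; elim: h k A => // h IH [|[|k]] A lekh evenk skewA //.
  by exists 1%:M => [|[]//]; rewrite trmx1 mulmx1.
have {}evenk : ~~ odd k by rewrite /= negbK in evenk.
have [x [y [t [xx yy xy xA yA]]]] := skew_invariant_pair evenk skewA.
have [P [PP Px Py]] := orthogonal_first_two_rows xx yy xy.
pose A' : 'M_(2 + k) := P *m A *m P^T.
have skewA' : A'^T = - A' := skew_congr P skewA.
(* In the new basis rows 0 and 1 are multiples of basis vectors 1 and 0, which clears the upper
   right block; skewness then clears the lower left one. *)
have ur0 : ursubmx A' = 0.
  have rowP0 j : row j P *m P^T = delta_mx 0 j by rewrite -row_mul PP row1.
  apply: (@ursubmx_row01_eq0 _ _ _ t (- t)); rewrite /A' !row_mul.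
    by rewrite Px xA -scalemxAl -Py rowP0.
  by rewrite Py yA -scalemxAl -Px rowP0.
have [|O OO OB] := IH k (drsubmx A') _ evenk (skew_drsubmx skewA').
  by rewrite ltnW.
pose Q : 'M_(2 + k) := block_mx (1%:M : 'M_2) 0 0 O.
exists (Q *m P); first exact: (orthogonal_mul (orthogonal_block 2 OO) PP).
have dl0 : dlsubmx A' = 0.
  by rewrite skew_dlsubmx // ur0 trmx0 oppr0.
have -> : (Q *m P) *m A *m (Q *m P)^T = Q *m A' *m Q^T by rewrite trmx_mul !mulmxA.
have A'E : A' = block_mx (ulsubmx A') 0 0 (drsubmx A').
  by rewrite -[LHS]submxK ur0 dl0.
have -> : Q *m A' *m Q^T = block_mx (ulsubmx A') 0 0 (O *m drsubmx A' *m O^T).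
  rewrite A'E /Q tr_block_mx !mulmx_block !trmx0 trmx1.
  rewrite !(mul0mx, mulmx0, mul1mx, mulmx1, addr0, add0r).
  by rewrite block_mxKul block_mxKdr.
suff blk0 (i j : 'I_(2 + k)) : i./2 != j./2 ->
    block_mx (ulsubmx A') 0 0 (O *m drsubmx A' *m O^T) i j = 0 by exact: blk0.
case: (splitP i) => i' ii'; case: (splitP j) => j' jj' ij.
- case/negP: ij; rewrite ii' jj'.
  by case: i' {ii'} => -[|[|?]] //; case: j' {jj'} => -[|[|?]].
- have -> : i = lshift k i' by apply: val_inj.
  have -> : j = rshift 2 j' by apply: val_inj.
  by rewrite block_mxEur mxE.
- have -> : i = rshift 2 i' by apply: val_inj.
  have -> : j = lshift k j' by apply: val_inj.
  by rewrite block_mxEdl mxE.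
have -> : i = rshift 2 i' by apply: val_inj.
have -> : j = rshift 2 j' by apply: val_inj.
rewrite block_mxEdr; apply: OB.
(* Adding 2 to an index adds 1 to its half, so the inequality of halves passes to the smaller
   block. *)
by move: ij; rewrite ii' jj'.
Qed.

(** The orthogonal matrix has determinant 1 or -1; in the second case negating its first row
    corrects the determinant and keeps the zero entries. *)
Lemma special_orthogonal_skew_normal_form (R : realType) (k : nat) (A : 'M[R]_k) :
  ~~ odd k -> A^T = - A ->
  exists2 Q : 'M[R]_k, SOmx Q &
    forall i j : 'I_k, i./2 != j./2 -> (Q *m A *m Q^T) i j = 0.
Proof.
move=> evenk skewA.
have [Q QQ Q0] := orthogonal_skew_normal_form evenk skewA.
have : (\det Q) ^+ 2 == 1.
  by rewrite expr2 -{2}det_tr -det_mulmx QQ det1.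
rewrite sqrf_eq1 => /orP[/eqP detQ|/eqP detQ]; first by exists Q.
case: k A evenk skewA Q QQ Q0 detQ => [|k] A evenk skewA Q QQ Q0 detQ.
  by exists Q => //; split; rewrite ?det_mx00.
pose d : 'rV[R]_k.+1 := \row_i (if i == 0 then -1 else 1).
have DD : diag_mx d *m (diag_mx d)^T = 1%:M.
  rewrite tr_diag_mx mulmx_diag -diag_const_mx; congr diag_mx.
  by apply/rowP=> i; rewrite !mxE; case: ifP => _; rewrite ?mulrNN mulr1.
exists (diag_mx d *m Q).
  split; first exact: orthogonal_mul.
  rewrite det_mulmx detQ det_diag big_ord_recl big1 => [|i _].
    by rewrite !mxE eqxx mulr1 mulrNN mulr1.
  by rewrite !mxE.
move=> i j ij; rewrite trmx_mul tr_diag_mx -!mulmxA mul_diag_mx !mulmxA.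
by rewrite mxE mul_mx_diag mxE Q0 // mul0r mulr0.
Qed.

(** * Hermitian and positive semidefinite matrices *)

Section Adjoint.
Variable C : numClosedFieldType.

Lemma adjointM (j k l : nat) (A : 'M[C]_(j, k)) (B : 'M[C]_(k, l)) :
  (A *m B)^t* = B^t* *m A^t*.
Proof. by rewrite trmx_mul map_mxM. Qed.

Lemma adjointZ (j k : nat) (a : C) (A : 'M[C]_(j, k)) :
  (a *: A)^t* = a^* *: A^t*.
Proof. by rewrite linearZ map_mxZ. Qed.

Lemma adjointD (j k : nat) (A B : 'M[C]_(j, k)) : (A + B)^t* = A^t* + B^t*.
Proof. by rewrite linearD map_mxD. Qed.

Lemma hermsymP {k : nat} {A : 'M[C]_k} : reflect (A^t* = A) (A \is hermsymmx).
Proof.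
by apply: (iffP (is_hermitianmxP _ _ _)); rewrite expr0 scale1r => /esym.
Qed.

Lemma hermsym1 (k : nat) : (1%:M : 'M[C]_k) \is hermsymmx.
Proof. by apply/hermsymP; rewrite trmx1 map_mx1. Qed.

Lemma hermsymD (k : nat) (A B : 'M[C]_k) :
  A \is hermsymmx -> B \is hermsymmx -> A + B \is hermsymmx.
Proof.
by move=> /hermsymP hA /hermsymP hB; apply/hermsymP; rewrite adjointD hA hB.
Qed.

Lemma hermsymZ (k : nat) (a : C) (A : 'M[C]_k) :
  a \is Num.real -> A \is hermsymmx -> a *: A \is hermsymmx.
Proof.
by move=> /CrealP ra /hermsymP hA; apply/hermsymP; rewrite adjointZ hA ra.
Qed.

Lemma hermsym0 (k : nat) : (0 : 'M[C]_k) \is hermsymmx.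
Proof. by apply/hermsymP; rewrite trmx0 map_mx0. Qed.

Lemma hermsym_sum (k : nat) (I : finType) (F : I -> 'M[C]_k) :
  (forall i, F i \is hermsymmx) -> \sum_i F i \is hermsymmx.
Proof.
move=> hF; elim/big_ind: _ => [||i _]; [exact: hermsym0|exact: hermsymD|exact: hF].
Qed.

(* Conjugation by X preserves the trace and negates A. *)
Lemma mxtrace_anticommute (k : nat) (X A : 'M[C]_k) :
  X *m X = 1%:M -> X *m A = - (A *m X) -> \tr A = 0.
Proof.
move=> XX XA; have : \tr A = - \tr A.
  rewrite -{1}[A]mul1mx -XX -mulmxA XA mulmxN linearN /= mxtrace_mulC.
  by rewrite -mulmxA XX mulmx1.
by move/eqP; rewrite -addr_eq0 -mulr2n -mulr_natr mulf_eq0 pnatr_eq0 orbF => /eqP.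
Qed.
End Adjoint.

Section Psd.
Variables (R : realType) (k : nat).
Implicit Types A B X : 'M[R[i]]_k.

Lemma psdmx0 : psdmx (0 : 'M[R[i]]_k).
Proof. by split=> [|v]; rewrite ?hermsym0 // mulmx0 mul0mx mxE. Qed.

Lemma psdmxD A B : psdmx A -> psdmx B -> psdmx (A + B).
Proof.
move=> [hA pA] [hB pB]; split=> [|v]; first exact: hermsymD.
by rewrite mulmxDr mulmxDl mxE addr_ge0.
Qed.

Lemma psdmxZ (a : R[i]) A : 0 <= a -> psdmx A -> psdmx (a *: A).
Proof.
move=> a0 [hA pA]; split=> [|v]; first by rewrite hermsymZ // ger0_real.
by rewrite -scalemxAr -scalemxAl mxE mulr_ge0.
Qed.

Lemma psdmx_congr X A : psdmx A -> psdmx (X^t* *m A *m X).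
Proof.
move=> [/hermsymP hA pA]; split=> [|v].
  by apply/hermsymP; rewrite !adjointM trmxCK hA mulmxA.
by have := pA (X *m v); rewrite adjointM !mulmxA.
Qed.

Lemma psdmx1 : psdmx (1%:M : 'M[R[i]]_k).
Proof.
split=> [|v]; first exact: hermsym1.
rewrite mulmx1 mxE sumr_ge0 // => i _.
by rewrite !mxE mulrC mul_conjC_ge0.
Qed.

Lemma psdmx_trace_ge0 A : psdmx A -> 0 <= \tr A.
Proof.
move=> [_ pA]; apply: sumr_ge0 => i _.
have := pA (delta_mx i 0).
by rewrite trmx_delta map_delta_mx -rowE -colE !mxE.
Qed.

(* (1 + h)^2 = 2 (1 + h), so tr (A (1 + h)) is half of tr ((1 + h) A (1 + h)). *)
Lemma psdmx_trace_involution A h : psdmx A -> h \is hermsymmx -> h *m h = 1%:M ->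
  0 <= \tr A + \tr (A *m h).
Proof.
move=> pA /hermsymP hh h2.
have := psdmx_trace_ge0 (psdmx_congr (1%:M + h) pA).
rewrite mxtrace_mulC adjointD hh trmx1 map_mx1 mulmxA.
have -> : (1%:M + h) *m (1%:M + h) = 2 *: (1%:M + h).
  rewrite mulmxDl !mulmxDr !mul1mx mulmx1 h2 scaler_nat mulr2n.
  by rewrite [h + _]addrC.
rewrite -scalemxAl mxtraceZ mulmxDl mul1mx mxtraceD (mxtrace_mulC h).
by rewrite pmulr_rge0.
Qed.
End Psd.

(** * Majorana operators *)

(** The factor ['i] turns the anti-Hermitian product of two Majorana operators into a Hermitian
    involution, whose expectation is the covariance entry of the mode. *)
Definition mode_op (R : realType) (n : nat)
    (c : 'I_(2 * n) -> 'M[R[i]]_(2 ^ n)) (k : 'I_n) : 'M[R[i]]_(2 ^ n) :=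
  'i *: (c (mode_fst k) *m c (mode_snd k)).

(** * Closure properties of even polynomials *)

Section EvenPolynomials.
Variables (R : realType) (n : nat) (c : 'I_(2 * n) -> 'M[R[i]]_(2 ^ n)).

Lemma even_polynomial1 : even_polynomial c 1%:M.
Proof. by exists [:: (1, [::])]; split; rewrite // big_seq1 big_nil scale1r. Qed.

Lemma even_polynomial0 : even_polynomial c 0.
Proof. by exists [::]; split; rewrite // big_nil. Qed.

Lemma even_polynomialD A B :
  even_polynomial c A -> even_polynomial c B -> even_polynomial c (A + B).
Proof.
move=> [s [es ->]] [t [et ->]]; exists (s ++ t).
by rewrite all_cat es et big_cat.
Qed.

Lemma even_polynomialZ a A : even_polynomial c A -> even_polynomial c (a *: A).
Proof.
move=> [s [es ->]]; exists [seq (a * t.1, t.2) | t <- s]; split.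
  by rewrite all_map.
by rewrite big_map scaler_sumr; apply: eq_bigr => t _; rewrite scalerA.
Qed.

Lemma even_polynomialM A B :
  even_polynomial c A -> even_polynomial c B -> even_polynomial c (A *m B).
Proof.
move=> [s [/allP es ->]] [t [/allP et ->]].
exists [seq (x.1 * y.1, x.2 ++ y.2) | x <- s, y <- t]; split.
  apply/allP=> _ /allpairsP[[x y] [/= xs yt ->]] /=.
  by rewrite size_cat oddD (negPf (es _ xs)) (negPf (et _ yt)).
rewrite big_allpairs_dep mulmx_suml; apply: eq_bigr => x _.
rewrite mulmx_sumr; apply: eq_bigr => y _ /=.
by rewrite big_cat -scalemxAl -scalemxAr scalerA.
Qed.

Lemma even_polynomial_sum (I : Type) (r : seq I) (P : pred I) F :
  (forall i, P i -> even_polynomial c (F i)) ->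
  even_polynomial c (\sum_(i <- r | P i) F i).
Proof.
by move=> eF; apply: big_ind => //; [exact: even_polynomial0|exact: even_polynomialD].
Qed.

Lemma even_polynomial_prod (I : Type) (r : seq I) (P : pred I) F :
  (forall i, P i -> even_polynomial c (F i)) ->
  even_polynomial c (\prod_(i <- r | P i) F i).
Proof.
by move=> eF; apply: big_ind => //; [exact: even_polynomial1|exact: even_polynomialM].
Qed.

(** A single rotated operator is linear in [c]; a product of two expands into words of length
    two. *)
Lemma even_polynomial_rotate2 (Q : 'M[R]_(2 * n)) j k :
  even_polynomial c (rotate Q c j *m rotate Q c k).
Proof.
rewrite mulmx_suml; apply: even_polynomial_sum => a _.
rewrite mulmx_sumr; apply: even_polynomial_sum => b _.
rewrite -scalemxAl -scalemxAr; do 2!apply: even_polynomialZ.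
exists [:: (1, [:: a; b])]; split => //.
by rewrite big_seq1 scale1r big_cons big_seq1.
Qed.

End EvenPolynomials.

(** * Orthogonal changes of the Majorana operators *)

Section Rotation.
Variables (R : realType) (n : nat) (c : 'I_(2 * n) -> 'M[R[i]]_(2 ^ n)).
Variable Q : 'M[R]_(2 * n).

Lemma rotate_mulmx j k :
  rotate Q c j *m rotate Q c k =
  \sum_a \sum_b ((Q j a)%:C * (Q k b)%:C) *: (c a *m c b).
Proof.
rewrite mulmx_suml; apply: eq_bigr => a _.
rewrite mulmx_sumr; apply: eq_bigr => b _.
by rewrite -scalemxAl -scalemxAr scalerA.
Qed.

(** By bilinearity, the anticommutator of two rotated operators is twice the inner product of the
    corresponding rows of [Q]. *)
Lemma majorana_rotate :
  Q *m Q^T = 1%:M -> majorana c -> majorana (rotate Q c).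
Proof.
move=> QQ [hc cc]; split=> [j|j k].
  apply: hermsym_sum => k; apply: hermsymZ => //.
  by apply/complex_realP; exists (Q j k).
(* Exchanging the sums in the second product pairs [c a *m c b] with [c b *m c a] under the same
   coefficient. *)
rewrite !rotate_mulmx [X in _ + X]exchange_big /= -big_split /=.
transitivity (\sum_a (2 * ((Q j a)%:C * (Q k a)%:C))%:M : 'M[R[i]]_(2 ^ n)).
  apply: eq_bigr => a _; rewrite -big_split /= (bigD1 a) //= big1 => [|b ba].
    rewrite addr0 [X in _ + X *: _]mulrC -scalerDr cc eqxx mulr1.
    by rewrite scale_scalar_mx mulrC.
  rewrite [X in _ + X *: _]mulrC -scalerDr cc eq_sym (negPf ba) mulr0.
  by rewrite scale_scalar_mx mulr0 raddf0.
rewrite -raddf_sum /= -mulr_sumr; congr (_ * _)%:M.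
have /matrixP/(_ j k) := QQ; rewrite !mxE => /(congr1 (real_complex R)).
rewrite rmorph_sum rmorph_nat => <-.
by apply: eq_bigr => a _; rewrite mxE rmorphM.
Qed.

Lemma covmx_rotate rho :
  covmx (rotate Q c) rho =
  map_mx (real_complex R) Q *m covmx c rho *m (map_mx (real_complex R) Q)^T.
Proof.
apply/matrixP=> j k; rewrite !mxE !rotate_mulmx [X in _ - X]exchange_big /=.
rewrite -sumrB mulmx_sumr raddf_sum /= mulr_sumr.
transitivity (\sum_a \sum_b (Q j a)%:C * covmx c rho a b * (Q k b)%:C).
  apply: eq_bigr => a _.
  rewrite -sumrB mulmx_sumr raddf_sum /= mulr_sumr; apply: eq_bigr => b _.
  rewrite [X in _ - X *: _]mulrC -scalerBr -scalemxAr mxtraceZ mxE; ring.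
rewrite exchange_big; apply: eq_bigr => b _; rewrite !mxE mulr_suml.
by apply: eq_bigr => a _; rewrite !mxE.
Qed.

End Rotation.

(** * Commutation relations of the mode operators *)

Section MajoranaAlgebra.
Variables (R : realType) (n : nat) (c : 'I_(2 * n) -> 'M[R[i]]_(2 ^ n)).
Hypothesis hc : majorana c.

Lemma majorana_sqr j : c j *m c j = 1%:M.
Proof.
have := hc.2 j j; rewrite eqxx mulr1 -mulr2n -scaler_nat -scalemx1.
by move/(congr1 ( *:%R 2^-1)); rewrite !scalerA mulVf ?pnatr_eq0 // !scale1r.
Qed.

Lemma majorana_anticomm j k : j != k -> c j *m c k = - (c k *m c j).
Proof.
by move=> jk; apply/eqP; rewrite -addr_eq0 hc.2 (negPf jk) mulr0 raddf0.
Qed.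

Lemma mode_fst_neq_snd (k l : 'I_n) : mode_fst k != mode_snd l.
Proof.
apply/eqP=> /(congr1 (fun j : 'I__ => odd j)) /=.
by rewrite !oddM.
Qed.

Lemma mode_snd_neq_fst (k l : 'I_n) : mode_snd k != mode_fst l.
Proof. by rewrite eq_sym mode_fst_neq_snd. Qed.

(** Passing [c j] through the two factors changes the sign twice; the next two lemmas involve only
    one sign change. *)
Lemma mode_op_comm j k : j != mode_fst k -> j != mode_snd k ->
  c j *m mode_op c k = mode_op c k *m c j.
Proof.
move=> jf js; rewrite /mode_op -scalemxAr -scalemxAl mulmxA (majorana_anticomm jf).
by rewrite mulNmx -[_ *m c j *m _]mulmxA (majorana_anticomm js) mulmxN opprK mulmxA.
Qed.

Lemma mode_op_fst k :
  c (mode_fst k) *m mode_op c k = - (mode_op c k *m c (mode_fst k)).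
Proof.
rewrite /mode_op -scalemxAr -scalemxAl -scalerN; congr (_ *: _).
by rewrite -mulmxA (majorana_anticomm (mode_snd_neq_fst k k)) mulmxN opprK.
Qed.

Lemma mode_op_snd k :
  c (mode_snd k) *m mode_op c k = - (mode_op c k *m c (mode_snd k)).
Proof.
rewrite /mode_op -scalemxAr -scalemxAl -scalerN; congr (_ *: _).
by rewrite mulmxA (majorana_anticomm (mode_snd_neq_fst k k)) mulNmx.
Qed.

Lemma mode_op_sqr k : mode_op c k *m mode_op c k = 1%:M.
Proof.
rewrite {1}/mode_op -scalemxAl -mulmxA mode_op_snd mulmxN mulmxA.
rewrite {1}/mode_op -scalemxAr -scalemxAl !mulmxA majorana_sqr mul1mx majorana_sqr.
by rewrite scalerN scalerA -expr2 sqrCi scaleN1r opprK.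
Qed.

Lemma mode_op_herm k : mode_op c k \is hermsymmx.
Proof.
apply/hermsymP; rewrite adjointZ adjointM.
rewrite (hermsymP (hc.1 _)) (hermsymP (hc.1 _)) conjCi.
by rewrite (majorana_anticomm (mode_snd_neq_fst k k)) scalerN scaleNr opprK.
Qed.

Lemma mode_inj (k l : 'I_n) : k != l ->
  (mode_fst k != mode_fst l) * (mode_snd k != mode_snd l).
Proof.
move=> kl; split; apply: contraNneq kl => -[] /eqP;
by rewrite ?eqSS ?eqn_pmul2l // => /eqP/val_inj ->.
Qed.

Lemma mode_op_commute k l : mode_op c k *m mode_op c l = mode_op c l *m mode_op c k.
Proof.
have [->//|kl] := eqVneq k l; have [ff ss] := mode_inj kl.
rewrite {1}/mode_op -scalemxAl -mulmxA mode_op_comm ?ss //; last first.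
  by rewrite eq_sym mode_fst_neq_snd.
rewrite mulmxA mode_op_comm ?ff ?mode_fst_neq_snd //.
by rewrite -mulmxA scalemxAr.
Qed.

End MajoranaAlgebra.

Lemma mode_cases (n : nat) (j : 'I_(2 * n)) :
  exists k : 'I_n, j = mode_fst k \/ j = mode_snd k.
Proof.
have kn : (j./2 < n)%N by rewrite ltn_half_double -mul2n.
exists (Ordinal kn); have := odd_double_half j.
by case: (odd j) => /= jE; [right|left]; apply: val_inj;
rewrite /= (mul2n j./2) -[LHS]jE.
Qed.

Lemma half_mode_fst (n : nat) (k : 'I_n) : (mode_fst k)./2 = k.
Proof. by rewrite /= mul2n doubleK. Qed.

Lemma half_mode_snd (n : nat) (k : 'I_n) : (mode_snd k)./2 = k.
Proof. by rewrite /= mul2n uphalf_double. Qed.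

(** A skew 2 by 2 block is determined by its entry above the diagonal. *)
Lemma skew_mode_ext (F : numFieldType) (n : nat) (A B : 'M[F]_(2 * n)) :
  A^T = - A -> B^T = - B ->
  (forall i j : 'I_(2 * n), i./2 != j./2 -> A i j = B i j) ->
  (forall k, A (mode_fst k) (mode_snd k) = B (mode_fst k) (mode_snd k)) ->
  A = B.
Proof.
have diag0 (M : 'M[F]_(2 * n)) j : M^T = - M -> M j j = 0.
  move=> /matrixP/(_ j j)/eqP; rewrite !mxE -addr_eq0 -mulr2n -mulr_natr.
  by rewrite mulf_eq0 pnatr_eq0 orbF => /eqP.
move=> skA skB offd fs; apply/matrixP=> i j.
have [ij|/offd//] := eqVneq (i./2) (j./2).
have [k] := mode_cases i; have [l] := mode_cases j.
case=> jE [] iE; move: ij; rewrite jE iE ?half_mode_fst ?half_mode_snd => /val_inj ->.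
- by rewrite !diag0.
- have /matrixP/(_ (mode_fst l) (mode_snd l)) := skA.
  have /matrixP/(_ (mode_fst l) (mode_snd l)) := skB.
  by rewrite !mxE fs => <-.
- exact: fs.
- by rewrite !diag0.
Qed.

Lemma sqr_affine_involution (K : comPzRingType) (k : nat) (a b : K) (h : 'M[K]_k) :
  h *m h = 1%:M ->
  (a *: 1%:M + b *: h) *m (a *: 1%:M + b *: h) =
  (a ^+ 2 + b ^+ 2) *: 1%:M + (a * b + a * b) *: h.
Proof.
move=> h2; rewrite mulmxDl !mulmxDr -!scalemxAl -!scalemxAr !mul1mx mulmx1 h2.
by rewrite !scalerA [X in _ + X]addrC addrACA -!scalerDl [b * a]mulrC.
Qed.

(** For an involution [h], these coefficients make [a + b h] a square root of [1 + x h]. *)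
Lemma sqrt_pair (R : rcfType) (x : R) : -1 <= x <= 1 ->
  exists a b : R, a ^+ 2 + b ^+ 2 = 1 /\ a * b + a * b = x.
Proof.
move=> /andP[x_ge x_le].
have [p0 m0] : 0 <= 1 + x /\ 0 <= 1 - x by split; lra.
(* Chosen so that [a + b] and [a - b] are the square roots of [1 + x] and [1 - x], the values of
   [1 + x h] at [h = 1] and [h = -1]. *)
exists ((Num.sqrt (1 + x) + Num.sqrt (1 - x)) / 2).
exists ((Num.sqrt (1 + x) - Num.sqrt (1 - x)) / 2).
have := sqr_sqrtr p0; have := sqr_sqrtr m0.
set u := Num.sqrt _; set v := Num.sqrt _ => vE uE; split.
  transitivity ((v ^+ 2 + u ^+ 2) / 2); first by field.
  by rewrite vE uE; field.
transitivity ((v ^+ 2 - u ^+ 2) / 2); first by field.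
by rewrite vE uE; field.
Qed.

(** * Covariance matrices as expectations *)

Section Covariance.
Variables (R : realType) (n : nat) (c : 'I_(2 * n) -> 'M[R[i]]_(2 ^ n)).

Lemma covmx_skew rho : (covmx c rho)^T = - covmx c rho.
Proof.
apply/matrixP=> j k; rewrite !mxE -[c k *m c j - _]opprB.
by rewrite mulmxN linearN mulrN.
Qed.

Lemma covmx_sum (I : finType) (a : I -> R[i]) (rho : I -> 'M[R[i]]_(2 ^ n)) :
  covmx c (\sum_i a i *: rho i) = \sum_i a i *: covmx c (rho i).
Proof.
apply/matrixP=> j k; rewrite summxE !mxE mulmx_suml raddf_sum mulr_sumr /=.
apply: eq_bigr => i _; rewrite -scalemxAl mxtraceZ !mxE.
by rewrite mulrCA.
Qed.

Hypothesis hc : majorana c.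

(** Distinct Majorana operators anticommute, so their commutator is twice their product. *)
Lemma covmx_offdiag rho j k : j != k ->
  covmx c rho j k = 'i * \tr (rho *m (c j *m c k)).
Proof.
rewrite eq_sym => kj; rewrite mxE (majorana_anticomm hc kj).
by rewrite opprK mulmxDr mxtraceD; field.
Qed.

Lemma covmx_mode rho k :
  covmx c rho (mode_fst k) (mode_snd k) = \tr (rho *m mode_op c k).
Proof.
by rewrite covmx_offdiag ?mode_fst_neq_snd // /mode_op -scalemxAr mxtraceZ.
Qed.

(** Both [mode_op c k] and its negative are Hermitian involutions, so [psdmx_trace_involution]
    yields [0 <= 1 + l] and [0 <= 1 - l]. *)
Lemma covmx_mode_bound rho (l : R) k : psdmx rho -> \tr rho = 1 ->
  covmx c rho (mode_fst k) (mode_snd k) = l%:C -> -1 <= l <= 1.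
Proof.
move=> prho trho; rewrite covmx_mode => lE.
have hh := mode_op_herm hc k; have h2 := mode_op_sqr hc k.
have := psdmx_trace_involution prho hh h2.
have : 0 <= \tr rho + \tr (rho *m (- mode_op c k)).
  apply: (psdmx_trace_involution prho); last by rewrite mulmxN mulNmx opprK h2.
  by rewrite -scaleN1r; apply: hermsymZ hh; rewrite rpredN rpred1.
rewrite mulmxN linearN /= trho lE -(rmorph1 (real_complex R)) -rmorphN -!rmorphD /=.
by rewrite !ler0c; lra.
Qed.

End Covariance.

(** * Gaussian states *)

Section GaussianProduct.
Variables (R : realType) (n : nat) (c : 'I_(2 * n) -> 'M[R[i]]_(2 ^ n)).
Hypothesis hc : majorana c.
Variable l : 'I_n -> R.

(** Unnormalised and over an arbitrary list of modes, so that traces and positivity go by induction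
    on the list. *)
Definition gaussian_prod (r : seq 'I_n) : 'M[R[i]]_(2 ^ n) :=
  \prod_(k <- r) (1%:M + (l k)%:C *: mode_op c k).

Lemma gaussian_prod_cons k r :
  gaussian_prod (k :: r) = (1%:M + (l k)%:C *: mode_op c k) *m gaussian_prod r.
Proof. by rewrite /gaussian_prod big_cons. Qed.

Lemma gaussian_prod_commute X r :
  (forall k, k \in r -> X *m mode_op c k = mode_op c k *m X) ->
  X *m gaussian_prod r = gaussian_prod r *m X.
Proof.
elim: r => [|k r IH] Xh; first by rewrite /gaussian_prod big_nil mul1mx mulmx1.
have Xk : X *m (1%:M + (l k)%:C *: mode_op c k) =
          (1%:M + (l k)%:C *: mode_op c k) *m X.
  rewrite mulmxDr mulmxDl mulmx1 mul1mx -scalemxAr -scalemxAl Xh //.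
  by rewrite mem_head.
rewrite gaussian_prod_cons mulmxA Xk -mulmxA IH ?mulmxA // => j jr.
by rewrite Xh // inE jr orbT.
Qed.

Lemma mode_fst_commute_prod k r : k \notin r ->
  c (mode_fst k) *m gaussian_prod r = gaussian_prod r *m c (mode_fst k).
Proof.
move=> kr; apply: gaussian_prod_commute => j jr.
rewrite mode_op_comm ?mode_fst_neq_snd //.
by rewrite mode_inj //; apply: contraNneq kr => ->.
Qed.

(** The Majorana operator anticommutes with [mode_op c k] and commutes with [Y], hence anticommutes
    with their product. *)
Lemma mxtrace_mode_op_mul k Y :
  c (mode_fst k) *m Y = Y *m c (mode_fst k) -> \tr (mode_op c k *m Y) = 0.
Proof.
move=> cY; apply: (@mxtrace_anticommute _ _ (c (mode_fst k))).
  exact: majorana_sqr.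
by rewrite mulmxA mode_op_fst // mulNmx -!mulmxA cY.
Qed.

(** When a factor is expanded, its [mode_op] term is traceless against the remaining factors; only
    the identity contributes. *)
Lemma mxtrace_gaussian_prod r : uniq r -> \tr (gaussian_prod r) = 2 ^+ n.
Proof.
elim: r => [_|k r IH /= /andP[kr ur]].
  by rewrite /gaussian_prod big_nil mxtrace1 natrX.
rewrite gaussian_prod_cons mulmxDl mul1mx mxtraceD IH // -scalemxAl mxtraceZ.
by rewrite mxtrace_mode_op_mul ?mulr0 ?addr0 // mode_fst_commute_prod.
Qed.

(** In the expansion only [l k] times the square of [mode_op c k], which is the identity, has
    nonzero trace. *)
Lemma mxtrace_gaussian_prod_mode r k : uniq r -> k \in r ->
  \tr (gaussian_prod r *m mode_op c k) = (l k)%:C * 2 ^+ n.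
Proof.
elim: r => [//|j r IH /= /andP[jr ur]]; rewrite inE gaussian_prod_cons.
have [-> _|kj /= kr] := eqVneq k j.
  rewrite -mulmxA mxtrace_mulC -mulmxA mulmxDr mulmx1 -scalemxAr mode_op_sqr //.
  rewrite mulmxDr -scalemxAr mulmx1 mxtraceD mxtraceZ mxtrace_gaussian_prod //.
  by rewrite mxtrace_mulC mxtrace_mode_op_mul ?add0r // mode_fst_commute_prod.
(* For a head [j] other than [k], the [mode_op] term vanishes because [c (mode_fst j)] commutes with
   the rest of the product and with [mode_op c k]. *)
rewrite !mulmxDl mul1mx mxtraceD IH // -mulmxA -scalemxAl mxtraceZ.
rewrite mxtrace_mode_op_mul ?mulr0 ?addr0 //.
rewrite mulmxA mode_fst_commute_prod // -!mulmxA mode_op_comm ?mode_fst_neq_snd //.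
by rewrite mode_inj // eq_sym.
Qed.

(** With [k] the mode of [i], the involution [mode_op c k] anticommutes with [c i] but commutes with
    [c j] and with the Gaussian product. *)
Lemma mxtrace_gaussian_prod_offmode r (i j : 'I_(2 * n)) : i./2 != j./2 ->
  \tr (gaussian_prod r *m (c i *m c j)) = 0.
Proof.
have [k ik] := mode_cases i => ij.
have hcj : c j *m mode_op c k = mode_op c k *m c j.
  apply: mode_op_comm => //; apply: contraNneq ij => ->; case: ik => ->;
  by rewrite ?half_mode_fst ?half_mode_snd.
have hci : c i *m mode_op c k = - (mode_op c k *m c i).
  by case: ik => ->; [exact: mode_op_fst|exact: mode_op_snd].
apply: (@mxtrace_anticommute _ _ (mode_op c k)); first exact: mode_op_sqr.
rewrite [LHS]mulmxA gaussian_prod_commute => [|*]; last exact: mode_op_commute.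
rewrite -!mulmxA hcj -mulmxN; congr (_ *m _).
by rewrite !mulmxA hci mulNmx opprK.
Qed.

(* Each factor 1 + l h is the square (a + b h)^2 of a Hermitian matrix that
   commutes with the other factors. *)
Lemma psdmx_gaussian_prod r :
  (forall k, -1 <= l k <= 1) -> psdmx (gaussian_prod r).
Proof.
move=> lb; elim: r => [|k r IH]; first by rewrite /gaussian_prod big_nil; apply: psdmx1.
have [a [b [ab1 abl]]] := sqrt_pair (lb k).
pose S := a%:C *: 1%:M + b%:C *: mode_op c k.
have SS : S *m S = 1%:M + (l k)%:C *: mode_op c k.
  rewrite sqr_affine_involution; last exact: mode_op_sqr.
  by rewrite -!rmorphXn -!rmorphM -!rmorphD /= ab1 abl scale1r.
have hS : S^t* = S.
  apply/hermsymP; apply: hermsymD; apply: hermsymZ.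
  - by apply/complex_realP; exists a.
  - exact: hermsym1.
  - by apply/complex_realP; exists b.
  - exact: mode_op_herm.
have SG : S *m gaussian_prod r = gaussian_prod r *m S.
  apply: gaussian_prod_commute => j _.
  move: (mode_op_commute hc k j); rewrite /S.
  move: (mode_op c k) (mode_op c j) => h h' hh'.
  rewrite mulmxDl mulmxDr -!scalemxAl -!scalemxAr mul1mx mulmx1 hh'.
  exact: erefl.
(* Moving one [S] to the right end exhibits the product as a congruence by the Hermitian matrix
   [S]. *)
rewrite gaussian_prod_cons -SS -mulmxA SG mulmxA -{1}hS.
exact: psdmx_congr.
Qed.

Lemma covmx_gaussian_prod_offmode r (i j : 'I_(2 * n)) : i./2 != j./2 ->
  covmx c ((2 ^+ n)^-1 *: gaussian_prod r) i j = 0.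
Proof.
move=> ij; have neq_ij : i != j by apply: contraNneq ij => ->.
rewrite (covmx_offdiag hc _ neq_ij) -scalemxAl mxtraceZ.
by rewrite (mxtrace_gaussian_prod_offmode r ij) !mulr0.
Qed.

Lemma covmx_gaussian_prod_mode r k : uniq r -> k \in r ->
  covmx c ((2 ^+ n)^-1 *: gaussian_prod r) (mode_fst k) (mode_snd k) = (l k)%:C.
Proof.
move=> ur kr; rewrite (covmx_mode hc) -scalemxAl mxtraceZ.
rewrite (mxtrace_gaussian_prod_mode ur kr) mulrCA mulVf ?mulr1 //.
by rewrite expf_neq0 ?pnatr_eq0.
Qed.

End GaussianProduct.

(** * Mixtures, change of frame and the resulting Gaussian state *)

(** Orthogonal congruence is invertible, so covariances may be compared in the rotated frame. *)
Lemma covmx_rotate_inj (R : realType) (n : nat) (c : 'I_(2 * n) -> 'M[R[i]]_(2 ^ n))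
    (Q : 'M[R]_(2 * n)) rho sigma :
  Q *m Q^T = 1%:M -> covmx (rotate Q c) rho = covmx (rotate Q c) sigma ->
  covmx c rho = covmx c sigma.
Proof.
move=> /mulmx1C QQ; rewrite !covmx_rotate; set QC := map_mx _ Q.
have QCQC : QC^T *m QC = 1%:M by rewrite /QC map_trmx -map_mxM QQ map_mx1.
move: (covmx c rho) (covmx c sigma) => A B /(congr1 (fun M => QC^T *m M *m QC)).
by rewrite !mulmxA QCQC !mul1mx -!mulmxA QCQC !mulmx1.
Qed.

Lemma covariance_matrix_convex (R : realType) (n : nat)
    (c : 'I_(2 * n) -> 'M[R[i]]_(2 ^ n)) (I : finType)
    (Gamma : I -> 'M[R]_(2 * n)) (p : I -> R) :
  (forall i, covariance_matrix c (Gamma i)) ->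
  (forall i, 0 <= p i) -> \sum_i p i = 1 ->
  covariance_matrix c (\sum_i p i *: Gamma i).
Proof.
(* A state is selected for every index; the witness is their mixture, and the covariance is linear
   in the state. *)
move=> /fin_all_exists[rho hrho] p0 p1; exists (\sum_i (p i)%:C *: rho i).
split; last first.
  rewrite /has_covariance covmx_sum rmorph_sum /=; apply: eq_bigr => i _.
  by rewrite map_mxZ (hrho i).2.
split.
- apply: even_polynomial_sum => i _; apply: even_polynomialZ.
  by have [[]] := hrho i.
- elim/big_ind: _ => [||i _]; [exact: psdmx0|exact: psdmxD|].
  by apply: psdmxZ; [rewrite ler0c|have [[]] := hrho i].
rewrite raddf_sum /= -[RHS](rmorph1 (real_complex R)) -p1 rmorph_sum.
apply: eq_bigr => i _; have [[_ _ tri] _] := hrho i.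
by rewrite mxtraceZ tri mulr1.
Qed.

Lemma covariance_matrix_skew (R : realType) (n : nat)
    (c : 'I_(2 * n) -> 'M[R[i]]_(2 ^ n)) (Gamma : 'M[R]_(2 * n)) :
  covariance_matrix c Gamma -> Gamma^T = - Gamma.
Proof.
move=> [rho [_ rhoG]]; apply: (@map_mx_inj _ _ (real_complex R)).
by rewrite -map_trmx map_mxN rhoG covmx_skew.
Qed.

(** The rotated operators are again Majorana operators, so positivity and trace are computed with
    them; evenness is checked in the original [c]. *)
Lemma gaussian_state_prod (R : realType) (n : nat)
    (c : 'I_(2 * n) -> 'M[R[i]]_(2 ^ n)) (Q : 'M[R]_(2 * n)) (l : 'I_n -> R) :
  majorana c -> SOmx Q -> (forall k, -1 <= l k <= 1) ->
  gaussian_state c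
    ((2 ^+ n)^-1 *: gaussian_prod (rotate Q c) l (index_enum 'I_n)).
Proof.
move=> hc SOQ lb; have hg := majorana_rotate SOQ.1 hc.
have prodE : gaussian_prod (rotate Q c) l (index_enum 'I_n) =
    \prod_(j < n) (1%:M + ('i * (l j)%:C) *:
      (rotate Q c (mode_fst j) *m rotate Q c (mode_snd j))).
  by apply: eq_bigr => j _; rewrite /mode_op scalerA mulrC.
split; last first.
  by exists Q, l; split; [exact: SOQ|exact: lb|rewrite prodE].
split.
- apply: even_polynomialZ; rewrite prodE; apply: even_polynomial_prod => j _.
  apply: even_polynomialD; first exact: even_polynomial1.
  by apply: even_polynomialZ; apply: even_polynomial_rotate2.
- apply: psdmxZ; last exact: psdmx_gaussian_prod.
  by rewrite invr_ge0 exprn_ge0.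
rewrite mxtraceZ (mxtrace_gaussian_prod hg l (index_enum_uniq _)).
by apply: mulVf; rewrite expf_neq0 ?pnatr_eq0.
Qed.

Unset Implicit Arguments.

Theorem lemma3p10 (R : realType) (n : nat)
    (c : 'I_(2 * n) -> 'M[R[i]]_(2 ^ n)) (hc : majorana c)
    (m : nat) (Gamma : 'I_m -> 'M[R]_(2 * n))
    (hGamma : forall i, covariance_matrix c (Gamma i))
    (p : 'I_m -> R) (hp0 : forall i, 0 <= p i) (hp1 : \sum_i p i = 1) :
  exists rho : 'M[R[i]]_(2 ^ n),
    gaussian_state c rho /\ has_covariance c rho (\sum_i p i *: Gamma i).
Proof.
have GG := covariance_matrix_convex hGamma hp0 hp1.
have Gskew := covariance_matrix_skew GG.
move: GG Gskew; set G := \sum_i _ => -[mix [[_ mix_psd mix_tr] mixG]] Gskew.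
have even2n : ~~ odd (2 * n) by rewrite oddM.
have [Q SOQ Qblock] := special_orthogonal_skew_normal_form even2n Gskew.
pose L := Q *m G *m Q^T; pose g := rotate Q c.
have hg : majorana g := majorana_rotate SOQ.1 hc.
have LE : map_mx (real_complex R) L = covmx g mix.
  by rewrite covmx_rotate -mixG !map_mxM map_trmx.
(* The parameters are the entries of the rotated covariance [L] above the diagonal of each block;
   positivity of the mixture bounds them. *)
pose l (k : 'I_n) : R := L (mode_fst k) (mode_snd k).
have lb k : -1 <= l k <= 1.
  by apply: (covmx_mode_bound hg mix_psd mix_tr); rewrite -LE mxE.
pose rho := (2 ^+ n)^-1 *: gaussian_prod g l (index_enum 'I_n).
exists rho; split; first exact: gaussian_state_prod.
suff rhoL : covmx g rho = covmx g mix.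
  by rewrite /has_covariance mixG (covmx_rotate_inj SOQ.1 rhoL).
(* Both matrices are skew and vanish off the blocks, which leaves one entry to compare per mode. *)
rewrite -LE; apply: skew_mode_ext.
- exact: covmx_skew.
- rewrite LE; exact: covmx_skew.
- by move=> i j ij; rewrite (covmx_gaussian_prod_offmode hg l _ ij) mxE Qblock.
move=> k; rewrite [RHS]mxE; apply: (covmx_gaussian_prod_mode hg).
  exact: index_enum_uniq.
exact: mem_index_enum.
Qed.
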